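(* Let $M$ be a connected topological manifold of dimension at least $2$ with an effective action of a finite group $G$, let $n\ge 2$, and let ${\bf x}=(x_1,\dots,x_n)\in F_G(M,n)$ be a base point such that every orbit $G(x_i)$ is of free type. Then $\pi_1^E(F_G(M,n),{\bf x},{\bf x}^{orb})$ forms a group under the operation $\bullet$, and the map $$\Lambda:\pi_1^E(F_G(M,n),{\bf x},{\bf x}^{orb})\longrightarrow \mathcal{B}_n^{orb}(M,G),\qquad [\alpha]\longmapsto[\widetilde{c(\alpha)}],$$ is a group isomorphism. In particular, the orbit braid group $\mathcal{B}_n^{orb}(M,G)$ is isomorphic to the extended fundamental group $\pi_1^E(F_G(M,n),{\bf x},{\bf x}^{orb})$.
   Context: Orbit configuration space: $F_G(M,n)=\{(y_1,\dots,y_n)\in M^{\times n}\mid G(y_i)\cap G(y_j)=\emptyset \text{ for } i\neq j\}$ with the subspace topology. $G^{\times n}$ acts coordinatewise on $F_G(M,n)$. For an $n$-tuple $y=(y_1,\dots,y_n)$ (of points, of paths or of group elements) and $\sigma\in\Sigma_n$ put $y_\sigma=(y_{\sigma(1)},\dots,y_{\sigma(n)})$. Products in $\Sigma_n$ are taken so that $(\sigma\tau)(i)=\tau(\sigma(i))$, i.e. $(y_\tau)_\sigma=y_{\sigma\tau}$. An orbit $G(y)$ is of free type if the isotropy group of $y$ is trivial. ${\bf x}^{orb}=\{g{\bf x}_\sigma\mid g\in G^{\times n},\sigma\in\Sigma_n\}$. Strings and orbit braids: $I=[0,1]$ carries the trivial $G$-action. A path $\alpha=(\alpha_1,\dots,\alpha_n):I\to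 F_G(M,n)$ determines the unordered collection of $n$ strings $c(\alpha)=\{c(\alpha_1),\dots,c(\alpha_n)\}$ in $M\times I$, $c(\alpha_i)=\{(\alpha_i(s),s)\mid s\in I\}$, and the unordered collection of orbit strings $\widetilde{c(\alpha)}=\{\widetilde{c(\alpha_1)},\dots,\widetilde{c(\alpha_n)}\}$, where $\widetilde{c(\alpha_i)}=\{h\,c(\alpha_i)\mid h\in G\}$ is a collection of strings. If $\alpha(0)={\bf x}$ and $\alpha(1)=g{\bf x}_\sigma$ for some $(g,\sigma)\in G^{\times n}\times\Sigma_n$, then $\widetilde{c(\alpha)}$ is called an orbit braid. The pair $(g,\sigma)$ is unique. Isotopy: for two paths $\alpha,\beta$ in $F_G(M,n)$ with the same endpoints, $c(\alpha)\sim^G_{iso}c(\beta)$ means that there are continuous maps $\widehat F_i:I\times I\to M\times I$, $\widehat F_i(s,t)=(F_i(s,t),s)$, $i=1,\dots,n$, such that (1) $\coprod_i\widehat F_i(s,0)=c(\alpha)$ and $\coprod_i\widehat F_i(s,1)=c(\beta)$; (2) for all $t$, $\coprod_i\widehat F_i(0,t)=c(\alpha)|_{s=0}=c(\beta)|_{s=0}$ and $\coprod_i\widehat F_i(1,t)=c(\alpha)|_{s=1}=c(\beta)|_{s=1}$; (3) $G(F_i(s,t))\cap G(F_j(s,t))=\emptyset$ for all $(s,t)$ and $i\ne j$. Equivalence: two orbit braids satisfy $\widetilde{c(\alpha)}\sim\widetilde{c(\beta)}$ if $c(g\alpha)\sim^G_{iso}c(h\beta)$ for some $g,h\in G^{\times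 n}$. $\mathcal{B}_n^{orb}(M,G)$ is the set of equivalence classes of orbit braids, with operation $[\widetilde{c(\alpha)}]*[\widetilde{c(\beta)}]=[\widetilde{c(\alpha)}\circ\widetilde{c(\beta)}]$, where $\circ$ glues the starting points of the orbit strings of $\widetilde{c(\beta)}$ to the ending points of those of $\widetilde{c(\alpha)}$ (first $\widetilde{c(\alpha)}$ on $[0,\frac12]$, then $\widetilde{c(\beta)}$ on $[\frac12,1]$); explicitly $\widetilde{c(\alpha)}\circ\widetilde{c(\beta)}=\widetilde{c(\alpha\circ(g\beta_\sigma))}$ where $\alpha(1)=g{\bf x}_\sigma$ and the inner $\circ$ is concatenation of paths. This is the orbit braid group. Extended fundamental group: $\pi_1^E(F_G(M,n),{\bf x},{\bf x}^{orb})$ is the set of homotopy classes relative to $\partial I$ of paths $\alpha:I\to F_G(M,n)$ with $\alpha(0)={\bf x}$, $\alpha(1)\in{\bf x}^{orb}$, with operation $[\alpha]\bullet[\beta]=[\alpha\circ(g\beta_\sigma)]$, where $\alpha(1)=g{\bf x}_\sigma$. *)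

(* Defs.v *)
From Stdlib Require Export RelationClasses.
From HB Require Import structures.
From mathcomp Require Export all_boot all_order all_algebra all_fingroup.
From mathcomp Require Export all_classical all_reals topology normedtype.
Export Order.TTheory GRing.Theory Num.Theory.
Export numFieldNormedType.Exports.

Set Implicit Arguments.
Unset Strict Implicit.
Unset Printing Implicit Defensive.

Local Open Scope classical_set_scope.
Local Open Scope ring_scope.

(* The quotient of [T] by [E] as a set of classes; it is the usual quotient
   whenever [E] is an equivalence relation. *)
Definition class_of {T : Type} (E : T -> T -> Prop) (t : T) : set T :=
  [set u | E t u].

Definition quot {T : Type} (E : T -> T -> Prop) :=
  {C : set T | exists t, C = class_of E t}.

Definition proj_quot {T : Type} (E : T -> T -> Prop) (t : T) : quot E :=
  exist _ (class_of E t) (ex_intro _ t erefl).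

Definition is_group {T : Type} (mul : T -> T -> T) : Prop :=
  associative mul /\
  exists (e : T) (inv : T -> T),
    [/\ left_id e mul, right_id e mul,
        left_inverse e inv mul & right_inverse e inv mul].

Definition locally_euclidean (R : realType) (d : nat) (M : topologicalType) :=
  forall p : M,
    exists (U : set M) (phi : M -> 'rV[R]_d) (psi : 'rV[R]_d -> M),
      [/\ open U, U p & open (phi @` U)] /\
      [/\ {within U, continuous phi}, {within phi @` U, continuous psi}
        & {in U, cancel phi psi}].

Definition topological_manifold (R : realType) (d : nat)
    (M : topologicalType) :=
  [/\ hausdorff_space M, @second_countable M & locally_euclidean R d M].

Record left_action (G : finGroupType) (M : topologicalType) := LeftAction {
  left_act :> G -> M -> M;
  left_act1 : forall p, left_act 1%g p = p;
  left_actM : forall g h p, left_act (g * h)%g p = left_act g (left_act h p);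
  left_act_continuous : forall g, continuous (left_act g) }.

Definition effective (G : finGroupType) (M : topologicalType)
    (a : left_action G M) :=
  forall g, (forall p, a g p = p) -> g = 1%g.

Definition I01 (R : realType) : topologicalType :=
  set_type (`[0, 1]%classic : set R).

Section UnitInterval.
Context {R : realType}.

Let clamp_subproof (r : R) :
  Num.max 0 (Num.min 1 r) \in (`[0, 1]%classic : set R).
Proof.
apply/mem_set; rewrite /= in_itv /= le_max lexx /=.
by rewrite ge_max ler01 ge_min lexx.
Qed.

(* The retraction of the line onto the unit interval. *)
Definition clamp (r : R) : I01 R :=
  exist (fun s => s \in `[0, 1]%classic) _ (clamp_subproof r).

Definition I0 : I01 R := clamp 0.
Definition I1 : I01 R := clamp 1.

Lemma clamp_continuous : continuous clamp.
Proof.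
apply/continuous_comp_initial.
rewrite (_ : _ \o _ = (fun r : R => Num.max 0 (Num.min 1 r))); last first.
  by apply/funext => r.
move=> r; apply: (@continuous_max R R (fun=> 0)); first exact: cvg_cst.
by apply: (@continuous_min R R (fun=> 1) id); [exact: cvg_cst|exact: cvg_id].
Qed.

(* First [u] on [0, 1/2], then [v] on [1/2, 1], both at double speed. *)
Definition path_cat {T : Type} (u v : I01 R -> T) (s : I01 R) : T :=
  if set_val s <= 2^-1 then u (clamp (2 * set_val s))
  else v (clamp (2 * set_val s - 1)).

Lemma set_val_clamp (r : R) : 0 <= r <= 1 -> set_val (clamp r) = r.
Proof.
by move=> /andP[r0 r1]; rewrite set_valE /= (min_idPr r1) (max_idPr r0).
Qed.

Lemma clampK (s : I01 R) : clamp (set_val s) = s.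
Proof.
apply/val_inj; apply: set_val_clamp.
by have := set_mem (valP s); rewrite /= in_itv.
Qed.

Lemma path_cat0 {T : Type} (u v : I01 R -> T) : path_cat u v I0 = u I0.
Proof.
by rewrite /path_cat set_val_clamp ?lexx ?ler01// mulr0 invr_ge0 ler0n.
Qed.

Lemma path_cat1 {T : Type} (u v : I01 R -> T) : path_cat u v I1 = v I1.
Proof.
rewrite /path_cat set_val_clamp ?lexx ?ler01//.
rewrite ifF; first by congr (v (clamp _)); rewrite mulr1 -[2]/(1 + 1) addrK.
by apply/negbTE; rewrite -ltNge invf_lt1 ?ltr1n.
Qed.

Lemma path_cat_continuous {T : topologicalType} (u v : I01 R -> T) :
  continuous u -> continuous v -> u I1 = v I0 -> continuous (path_cat u v).
Proof.
move=> cu cv uv.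
pose A : set (I01 R) := set_val @^-1` [set r | r <= 2^-1].
pose B : set (I01 R) := set_val @^-1` [set r | 2^-1 <= r].
have cval : continuous (set_val : I01 R -> R) by exact: initial_continuous.
have c2 : continuous (fun s : I01 R => 2 * set_val s).
  move=> s; apply: (@continuousM _ _ (fun=> 2) set_val s); last exact: cval.
  exact: (@cst_continuous (I01 R) R 2 s).
apply/continuous_subspace_setT.
rewrite (_ : setT = A `|` B); last first.
  apply/esym/seteqP; split=> // s _; rewrite /A /B /=.
  by have [|/ltW] := leP (set_val s) 2^-1; [left|right].
apply: withinU_continuous.
- by apply: preimage_closed; [move=> t _; exact: cval|exact: (@closed_le R)].
- by apply: preimage_closed; [move=> t _; exact: cval|exact: closed_ge].
- apply: (@subspace_eq_continuous (I01 R) A T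
    (fun s => u (clamp (2 * set_val (s : I01 R))))).
    by move=> s /set_mem sA; rewrite /from_subspace /path_cat /= ifT.
  apply: (@continuous_subspaceT _ _ _
    (fun s : I01 R => u (clamp (2 * set_val s)))) => s.
  apply: (@continuous_comp _ _ _ (fun s : I01 R => clamp (2 * set_val s)) u).
    apply: (@continuous_comp _ _ _ (fun s : I01 R => 2 * set_val s) clamp).
      exact: c2.
    exact: clamp_continuous.
  exact: cu.
- apply: (@subspace_eq_continuous (I01 R) B T
    (fun s => v (clamp (2 * set_val (s : I01 R) - 1)))).
    move=> s /set_mem sB; rewrite /from_subspace /path_cat /=.
    have [sA|//] := leP (set_val s) 2^-1.
    have -> : set_val s = 2^-1 by apply/le_anti; rewrite sA sB.
    by rewrite mulfV ?pnatr_eq0// subrr.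
  apply: (@continuous_subspaceT _ _ _
    (fun s : I01 R => v (clamp (2 * set_val s - 1)))) => s.
  apply: (@continuous_comp _ _ _
    (fun s : I01 R => clamp (2 * set_val s - 1)) v).
    apply: (@continuous_comp _ _ _ (fun s : I01 R => 2 * set_val s - 1) clamp).
      apply: (@continuousB _ _ _ (fun s : I01 R => 2 * set_val s) (fun=> 1) s).
        exact: c2.
      exact: (@cst_continuous (I01 R) R 1 s).
    exact: clamp_continuous.
  exact: cv.
Qed.

End UnitInterval.

Section OrbitConfiguration.
Context {G : finGroupType} {M : topologicalType} (a : left_action G M).

Definition Gorbit (p : M) : set M := [set a g p | g in [set: G]].

Definition isotropy (p : M) : set G := [set g | a g p = p].

Definition free_type (p : M) := isotropy p = [set 1%g].

Lemma Gorbit_act g p : Gorbit (a g p) = Gorbit p.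
Proof.
apply/seteqP; split=> q [h _ <-]; first by exists (h * g)%g; rewrite ?left_actM.
by exists (h * g^-1)%g => //; rewrite -left_actM mulgKV.
Qed.

Definition conf_set (n : nat) : set (prod_topology (fun _ : 'I_n => M)) :=
  [set y | forall i j, i != j -> Gorbit (y i) `&` Gorbit (y j) = set0].

Arguments conf_set n : clear implicits.

Definition conf (n : nat) : topologicalType := set_type (conf_set n).

Context {n : nat}.

Let conf_act_subproof (g : 'I_n -> G) (y : conf n) :
  (fun i => a (g i) (set_val y i)) \in conf_set n.
Proof.
apply/mem_set => i j ij; rewrite !Gorbit_act.
exact: (set_mem (valP y)).
Qed.

Definition conf_act (g : 'I_n -> G) (y : conf n) : conf n :=
  exist (fun z => z \in conf_set n) _ (conf_act_subproof g y).

Let conf_perm_subproof (y : conf n) (s : 'S_n) :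
  (fun i => set_val y (s i)) \in conf_set n.
Proof.
apply/mem_set => i j ij.
by apply: (set_mem (valP y)); rewrite (inj_eq perm_inj).
Qed.

Definition conf_perm (y : conf n) (s : 'S_n) : conf n :=
  exist (fun z => z \in conf_set n) _ (conf_perm_subproof y s).

Lemma prod_continuous {X : topologicalType}
    (f : X -> prod_topology (fun _ : 'I_n => M)) :
  (forall i, continuous (fun z => f z i)) -> continuous f.
Proof.
move=> cf z; apply/cvg_sup => i U [_ [[W oW <-]] /= Wf] /filterS; apply.
by apply: cf; exact: open_nbhs_nbhs.
Qed.

Lemma conf_coord_continuous i : continuous (fun y : conf n => set_val y i).
Proof.
move=> y; apply: (@continuous_comp _ _ _ set_val
  (fun z : prod_topology (fun _ : 'I_n => M) => z i)).
  exact: initial_continuous.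
exact: (@proj_continuous _ (fun _ : 'I_n => M)).
Qed.

Lemma conf_act_continuous g : continuous (conf_act g).
Proof.
apply/continuous_comp_initial/prod_continuous => i y.
apply: (@continuous_comp _ _ _ (fun y : conf n => set_val y i) (a (g i))).
  exact: conf_coord_continuous.
exact: left_act_continuous.
Qed.

Lemma conf_perm_continuous s : continuous (conf_perm ^~ s).
Proof.
by apply/continuous_comp_initial/prod_continuous => i; exact: conf_coord_continuous.
Qed.

Lemma conf_permA (y : conf n) (t s : 'S_n) :
  conf_perm (conf_perm y t) s = conf_perm y (s * t)%g.
Proof. by apply/val_inj/funext => i /=; rewrite permM. Qed.

Lemma conf_act_perm (g : 'I_n -> G) (y : conf n) (s : 'S_n) :
  conf_perm (conf_act g y) s = conf_act (g \o s) (conf_perm y s).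
Proof. exact/val_inj. Qed.

Lemma conf_actM (g h : 'I_n -> G) (y : conf n) :
  conf_act g (conf_act h y) = conf_act (fun i => (g i * h i)%g) y.
Proof. by apply/val_inj/funext => i /=; rewrite left_actM. Qed.

End OrbitConfiguration.

Section OrbitBraids.
Context (R : realType) {G : finGroupType} {M : topologicalType}.
Context {a : left_action G M} {n : nat} (x : conf a n).

Local Notation I := (I01 R).

Definition conf_orb : set (conf a n) :=
  [set y | exists (g : 'I_n -> G) (s : 'S_n), y = conf_act g (conf_perm x s)].

Record orb_path := OrbPath {
  orb_path_fun :> I -> conf a n;
  orb_path_continuous : continuous orb_path_fun;
  orb_path0 : orb_path_fun I0 = x;
  orb_path1 : conf_orb (orb_path_fun I1) }.

(* The path alpha o (g beta_sigma). *)
Definition orb_cat_fun (alpha beta : I -> conf a n) (g : 'I_n -> G)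
    (s : 'S_n) : I -> conf a n :=
  path_cat alpha (fun t => conf_act g (conf_perm (beta t) s)).

Section OrbCat.
Context (alpha beta : orb_path) (g : 'I_n -> G) (s : 'S_n).
Hypothesis alpha1 : alpha I1 = conf_act g (conf_perm x s).

Let orb_cat_continuous : continuous (orb_cat_fun alpha beta g s).
Proof.
apply: path_cat_continuous.
- exact: orb_path_continuous.
- move=> t; apply: (@continuous_comp _ _ _ (fun t => conf_perm (beta t) s)
    (conf_act g)).
    apply: (@continuous_comp _ _ _ beta (fun y : conf a n => conf_perm y s)).
      exact: orb_path_continuous.
    exact: conf_perm_continuous.
  exact: conf_act_continuous.
- by rewrite alpha1 orb_path0.
Qed.

Let orb_cat0 : orb_cat_fun alpha beta g s I0 = x.
Proof. by rewrite /orb_cat_fun path_cat0 orb_path0. Qed.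

Let orb_cat1 : conf_orb (orb_cat_fun alpha beta g s I1).
Proof.
rewrite /orb_cat_fun path_cat1; have [h [t ->]] := orb_path1 beta.
by rewrite conf_act_perm conf_actM conf_permA; eexists _, _.
Qed.

Definition orb_cat : orb_path := OrbPath orb_cat_continuous orb_cat0 orb_cat1.

End OrbCat.

(* Homotopy relative to the boundary of [I]. *)
Definition homotopic (alpha beta : orb_path) : Prop :=
  exists H : I * I -> conf a n,
    [/\ continuous H,
        forall s, H (s, I0) = alpha s /\ H (s, I1) = beta s
      & forall t, H (I0, t) = alpha I0 /\ H (I1, t) = alpha I1].

Definition pi1E := quot homotopic.

Definition pi1E_class (alpha : orb_path) : pi1E := proj_quot homotopic alpha.

Definition string (u : I -> M) : set (M * I) := [set (u s, s) | s in [set: I]].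

Definition strings (u : I -> conf a n) : set (set (M * I)) :=
  [set string (fun s => set_val (u s) i) | i in [set: 'I_n]].

(* [G] acts trivially on the factor [I] of [M * I]. *)
Definition act_string (h : G) (S : set (M * I)) : set (M * I) :=
  [set (a h p.1, p.2) | p in S].

Definition orbit_string (S : set (M * I)) : set (set (M * I)) :=
  [set act_string h S | h in [set: G]].

Definition orbit_strings (u : I -> conf a n) : set (set (set (M * I))) :=
  [set orbit_string S | S in strings u].

Definition at_level (C : set (set (M * I))) (s : I) : set (M * I) :=
  [set p | p.2 = s /\ exists2 S, C S & S p].

(* The relation c(alpha) ~ c(beta); a disjoint union of strings is read as the
   unordered collection of these strings. *)
Definition isotopic (alpha beta : I -> conf a n) : Prop :=
  [/\ alpha I0 = beta I0, alpha I1 = beta I1 &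
  exists F : 'I_n -> I * I -> M,
    let Fhat i (p : I * I) : M * I := (F i p, p.1) in
    let Fstrings t : set (set (M * I)) :=
      [set [set Fhat i (s, t) | s in [set: I]] | i in [set: 'I_n]] in
    let Fpoints s t : set (M * I) := [set Fhat i (s, t) | i in [set: 'I_n]] in
    [/\ forall i, continuous (Fhat i),
        Fstrings I0 = strings alpha /\ Fstrings I1 = strings beta,
        forall t, Fpoints I0 t = at_level (strings alpha) I0 /\
                  Fpoints I0 t = at_level (strings beta) I0,
        forall t, Fpoints I1 t = at_level (strings alpha) I1 /\
                  Fpoints I1 t = at_level (strings beta) I1
      & forall s t i j, i != j ->
          Gorbit a (F i (s, t)) `&` Gorbit a (F j (s, t)) = set0]].

Definition orbit_braid :=
  {B : set (set (set (M * I))) |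
    exists alpha : orb_path, B = orbit_strings alpha}.

Definition braid_of (alpha : orb_path) : orbit_braid :=
  exist _ (orbit_strings alpha) (ex_intro _ alpha erefl).

Definition braid_equiv (B C : orbit_braid) : Prop :=
  exists alpha beta : orb_path,
    [/\ B = braid_of alpha, C = braid_of beta &
        exists g h : 'I_n -> G,
          isotopic (fun s => conf_act g (alpha s))
                   (fun s => conf_act h (beta s))].

Definition orbit_braid_group := quot braid_equiv.

Definition braid_class (alpha : orb_path) : orbit_braid_group :=
  proj_quot braid_equiv (braid_of alpha).

End OrbitBraids.

(* Main.v *)
(** Freeness of the orbits of the base point makes everything rigid: the pair
    [(g, s)] with [alpha I1 = g x_s] is unique, an orbit braid determines the
    path starting at [x] that it comes from, and an isotopy from [c(g alpha)] to
    [c(h beta)] forces [g = h].  In an isotopy the end points of the strings move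
    inside a finite subset of the Hausdorff space [M], so they are fixed, and an
    isotopy is a homotopy relative to the boundary of [I].  Hence equivalence of
    orbit braids is homotopy of paths and [Lambda] is a bijection.  The group
    laws come from reparametrising concatenations; the inverse of [alpha] is
    the reversed path translated back to [x]. *)

Require Import Defs.
From mathcomp Require Import lra.
Set Implicit Arguments.
Unset Strict Implicit.
Unset Printing Implicit Defensive.

Local Open Scope classical_set_scope.
Local Open Scope ring_scope.

(** * Quotients by equivalence relations, and criteria for groups *)

Lemma proj_quotP {T : Type} (E : T -> T -> Prop) (t u : T) :
  Equivalence E -> proj_quot E t = proj_quot E u <-> E t u.
Proof.
move=> [Er Es Et]; split=> [/(congr1 sval) /= tu|tu].
  by have : class_of E u u by []; rewrite -tu.
apply/eq_exist/seteqP; split=> v /=; last exact: Et.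
by apply: Et; exact: Es.
Qed.

Lemma proj_quot_surj {T : Type} (E : T -> T -> Prop) (c : quot E) :
  exists t, c = proj_quot E t.
Proof. by case: c => C [t Ct]; exists t; exact/eq_exist. Qed.

Section QuotRep.
Context {T : Type} {E : T -> T -> Prop}.

Definition quot_rep (c : quot E) : T := sval (cid (proj_quot_surj c)).

Lemma quot_repK (c : quot E) : proj_quot E (quot_rep c) = c.
Proof. by rewrite /quot_rep; case: cid. Qed.

Lemma quot_rep_proj (t : T) : Equivalence E -> E (quot_rep (proj_quot E t)) t.
Proof. by move=> eqE; apply/(proj_quotP _ _ eqE); exact: quot_repK. Qed.

End QuotRep.

(** The element [inv u] has a right inverse of its own; multiplying [inv u * u] by
    [inv u * inv (inv u) = e] collapses it to [e]. Right inverses are thus left inverses, and the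
    left unit law follows from [e * u = u * (inv u * u)]. Only right-hand laws then have to be
    checked for paths. *)
Lemma is_group_right {T : Type} (mul : T -> T -> T) (e : T) :
  associative mul -> right_id e mul -> (forall u, exists v, mul u v = e) ->
  is_group mul.
Proof.
move=> mulA mul1 /choice[inv mulV]; have mulVl : left_inverse e inv mul.
  move=> u; rewrite -[LHS]mul1 -(mulV (inv u)) mulA -(mulA (inv u)) mulV.
  by rewrite mul1.
split=> //; exists e, inv; split=> // u.
by rewrite -(mulV u) -mulA mulVl mul1.
Qed.

(** Serves to carry the group structure of [pi1E] over to orbit braids along the bijection
    [Lambda]. *)
Lemma is_group_transport {T U : Type} (mul : T -> T -> T) (f : T -> U)
    (f' : U -> T) :
  cancel f f' -> cancel f' f -> is_group mul ->
  is_group (fun u v => f (mul (f' u) (f' v))).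
Proof.
move=> fK f'K [mulA [e [inv [mul1l mul1r mulVl mulVr]]]].
split=> [u v w|]; first by rewrite !fK mulA.
exists (f e), (f \o inv \o f').
by split=> u /=; rewrite !fK ?mul1l ?mul1r ?mulVl ?mulVr.
Qed.

(** * Global forms of the basic continuity rules *)

Section Continuity.
Context {X Y Z : topologicalType}.

Lemma id_cts : continuous (fun z : X => z).
Proof. by move=> z; exact: cvg_id. Qed.

Lemma fst_cts : continuous (fst : X * Y -> X).
Proof. by move=> z; exact: cvg_fst. Qed.

Lemma snd_cts : continuous (snd : X * Y -> Y).
Proof. by move=> z; exact: cvg_snd. Qed.

Lemma comp_cts (f : X -> Y) (g : Y -> Z) :
  continuous f -> continuous g -> continuous (fun z => g (f z)).
Proof. by move=> cf cg z; apply: continuous_comp; [exact: cf|exact: cg]. Qed.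

Lemma pair_cts (f : X -> Y) (g : X -> Z) :
  continuous f -> continuous g -> continuous (fun z => (f z, g z)).
Proof. by move=> cf cg z; apply: cvg_pair; [exact: cf|exact: cg]. Qed.

Context {R : realType}.
Implicit Types f g : X -> R.

Lemma add_cts f g :
  continuous f -> continuous g -> continuous (fun z => f z + g z).
Proof. by move=> cf cg z; apply: continuousD; [exact: cf|exact: cg]. Qed.

Lemma sub_cts f g :
  continuous f -> continuous g -> continuous (fun z => f z - g z).
Proof. by move=> cf cg z; apply: continuousB; [exact: cf|exact: cg]. Qed.

Lemma mul_cts f g :
  continuous f -> continuous g -> continuous (fun z => f z * g z).
Proof. by move=> cf cg z; apply: continuousM; [exact: cf|exact: cg]. Qed.

Lemma min_cts f g :
  continuous f -> continuous g -> continuous (fun z => Num.min (f z) (g z)).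
Proof. by move=> cf cg z; apply: continuous_min; [exact: cf|exact: cg]. Qed.

End Continuity.

(** * The unit interval, pasting, and concatenation in families *)

Section PathHomotopy.
Context {R : realType}.
Local Notation I := (I01 R).

Lemma set_val_I01 (s : I) : 0 <= set_val s <= 1.
Proof. by have := set_mem (valP s); rewrite /= in_itv. Qed.

Lemma set_val_I0 : set_val (I0 : I) = 0.
Proof. by rewrite set_val_clamp ?lexx ?ler01. Qed.

Lemma set_val_I1 : set_val (I1 : I) = 1.
Proof. by rewrite set_val_clamp ?lexx ?ler01. Qed.

Lemma set_val_continuous : continuous (set_val : I -> R).
Proof. exact: initial_continuous. Qed.

Lemma I01_connected : connected [set: I].
Proof.
have -> : [set: I] = clamp @` [set: R].
  by apply/esym/seteqP; split=> // s _; exists (set_val s); rewrite ?clampK.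
apply: connected_continuous_connected.
  by rewrite -set_itvNyy; exact/connected_intervalP/interval_is_interval.
by apply: continuous_subspaceT => r; exact: clamp_continuous.
Qed.

Lemma glue_continuous {X T : topologicalType} (f : X -> R) (c : R)
    (u v : X -> T) :
  continuous f -> continuous u -> continuous v ->
  (forall z, f z = c -> u z = v z) ->
  continuous (fun z => if f z <= c then u z else v z).
Proof.
move=> cf cu cv uv.
apply/continuous_subspace_setT.
pose A : set X := f @^-1` [set r | r <= c].
pose B : set X := f @^-1` [set r | c <= r].
rewrite (_ : setT = A `|` B); last first.
  apply/esym/seteqP; split=> // s _; rewrite /A /B /=.
  by have [|/ltW] := leP (f s) c; [left|right].
apply: withinU_continuous.
- by apply: preimage_closed; [move=> t _; exact: cf|exact: (@closed_le R)].
- by apply: preimage_closed; [move=> t _; exact: cf|exact: closed_ge].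
- apply: (@subspace_eq_continuous X A T u); last exact: continuous_subspaceT.
  by move=> s /set_mem sA; rewrite /from_subspace /= ifT.
- apply: (@subspace_eq_continuous X B T v); last exact: continuous_subspaceT.
  move=> s /set_mem sB; rewrite /from_subspace /=.
  have [sA|//] := leP (f s) c.
  by rewrite uv//; apply/le_anti; rewrite sA sB.
Qed.

(** Both the two paths and the time [p z] vary with [z]. With [p = snd] this stacks two homotopies
    in the deformation parameter (transitivity); with [p = fst] it places them side by side
    (compatibility with concatenation). *)
Lemma path_cat_family_continuous {X T : topologicalType} (p : X -> I)
    (u v : X -> I -> T) :
  continuous p -> continuous (fun z : X * I => u z.1 z.2) ->
  continuous (fun z : X * I => v z.1 z.2) -> (forall z, u z I1 = v z I0) ->
  continuous (fun z => path_cat (u z) (v z) (p z)).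
Proof.
move=> cp cu cv uv.
have cf := comp_cts cp set_val_continuous.
have c2 := mul_cts (@cst_continuous X R 2) cf.
apply: glue_continuous.
- exact: cf.
- apply: (comp_cts (f := fun z => (z, clamp (2 * set_val (p z)))) _ cu).
  exact: pair_cts (@id_cts X) (comp_cts c2 clamp_continuous).
- apply: (comp_cts (f := fun z => (z, clamp (2 * set_val (p z) - 1))) _ cv).
  apply: pair_cts (@id_cts X) (comp_cts _ clamp_continuous).
  exact: sub_cts c2 (@cst_continuous X R 1).
- by move=> z zc; rewrite zc mulfV ?pnatr_eq0// subrr.
Qed.

(** * Homotopy of paths relative to the end points *)

Section Homotopy.
Context {T : topologicalType}.
Implicit Types (u v w : I -> T) (H : I * I -> T).

(** The relation [homotopic], freed from orbit paths: translated paths [g beta_s] no longer start at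
    the base point, but still have to be deformed. *)
Definition path_homotopic u v : Prop :=
  exists H : I * I -> T,
    [/\ continuous H,
        forall s, H (s, I0) = u s /\ H (s, I1) = v s
      & forall t, H (I0, t) = u I0 /\ H (I1, t) = u I1].

Lemma path_homotopic0 u v : path_homotopic u v -> v I0 = u I0.
Proof. by move=> [H [_ /(_ I0)[_ <-] /(_ I1)[->]]]. Qed.

Lemma path_homotopic1 u v : path_homotopic u v -> v I1 = u I1.
Proof. by move=> [H [_ /(_ I1)[_ <-] /(_ I1)[_ ->]]]. Qed.

Lemma path_homotopic_refl u : continuous u -> path_homotopic u u.
Proof.
move=> cu; exists (fun p => u p.1); split=> //.
exact: comp_cts (@fst_cts I I) cu.
Qed.

(** The interval is convex, so [p] and [q] are joined by the straight-line homotopy, which is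
    constant where they agree. The associativity, unit and inverse laws below all reduce to this
    lemma. *)
Lemma path_homotopic_reparam u (p q : I -> I) :
  continuous u -> continuous p -> continuous q -> p I0 = q I0 ->
  p I1 = q I1 -> path_homotopic (u \o p) (u \o q).
Proof.
move=> cu cp cq pq0 pq1.
exists (fun z => u (clamp (set_val (p z.1) +
  set_val z.2 * (set_val (q z.1) - set_val (p z.1))))).
have cv (r : I -> I) : continuous r ->
    continuous (fun z : I * I => set_val (r z.1)).
  move=> cr.
  exact: comp_cts (comp_cts (@fst_cts I I) cr) set_val_continuous.
split=> [|s|t] /=.
- apply: comp_cts cu; apply: comp_cts clamp_continuous.
  apply: add_cts (cv _ cp) (mul_cts _ (sub_cts (cv _ cq) (cv _ cp))).
  exact: comp_cts (@snd_cts I I) set_val_continuous.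
- by rewrite set_val_I0 set_val_I1 mul0r mul1r addr0 addrC subrK !clampK.
- by rewrite pq0 pq1 !subrr !mulr0 !addr0 !clampK.
Qed.

Lemma path_homotopic_sym u v : path_homotopic u v -> path_homotopic v u.
Proof.
move=> uv; have [H [cH H01 Hb]] := uv.
exists (fun z => H (z.1, clamp (1 - set_val z.2))); split=> [|s|t] /=.
- apply: (comp_cts (f := fun z : I * I => (z.1, clamp (1 - set_val z.2))) _ cH).
  apply: pair_cts (@fst_cts I I) (comp_cts _ clamp_continuous).
  apply: sub_cts; first exact: cst_continuous.
  exact: comp_cts (@snd_cts I I) set_val_continuous.
- by rewrite set_val_I0 set_val_I1 subr0 subrr; have [] := H01 s.
- by rewrite (path_homotopic0 uv) (path_homotopic1 uv).
Qed.

Lemma path_homotopic_trans u v w :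
  path_homotopic u v -> path_homotopic v w -> path_homotopic u w.
Proof.
move=> uv vw; have [H [cH H01 Hb]] := uv; have [K [cK K01 Kb]] := vw.
exists (fun z => path_cat (fun t => H (z.1, t)) (fun t => K (z.1, t)) z.2).
split=> [|s|t] /=.
- apply: (path_cat_family_continuous (p := snd)).
  + exact: snd_cts.
  + apply: (comp_cts (f := fun z : (I * I) * I => (z.1.1, z.2)) _ cH).
    exact: pair_cts (comp_cts (@fst_cts _ I) (@fst_cts I I)) (@snd_cts _ I).
  + apply: (comp_cts (f := fun z : (I * I) * I => (z.1.1, z.2)) _ cK).
    exact: pair_cts (comp_cts (@fst_cts _ I) (@fst_cts I I)) (@snd_cts _ I).
  + by move=> z; have [_ ->] := H01 z.1; have [->] := K01 z.1.
- by rewrite path_cat0 path_cat1; have [-> _] := H01 s; have [_ ->] := K01 s.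
- have HI r : H (I0, r) = u I0 /\ H (I1, r) = u I1 by exact: Hb.
  have KI r : K (I0, r) = u I0 /\ K (I1, r) = u I1.
    by have [-> ->] := Kb r; rewrite (path_homotopic0 uv) (path_homotopic1 uv).
  rewrite /path_cat; case: ifP => _; first exact: HI.
  exact: KI.
Qed.

Lemma path_homotopic_cat u u' v v' : u I1 = v I0 ->
  path_homotopic u u' -> path_homotopic v v' ->
  path_homotopic (path_cat u v) (path_cat u' v').
Proof.
move=> uv [H [cH H01 Hb]] [K [cK K01 Kb]].
exists (fun z => path_cat (fun s => H (s, z.2)) (fun s => K (s, z.2)) z.1).
split=> [|s|t] /=.
- apply: (path_cat_family_continuous (p := fst)).
  + exact: fst_cts.
  + apply: (comp_cts (f := fun z : (I * I) * I => (z.2, z.1.2)) _ cH).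
    exact: pair_cts (@snd_cts _ I) (comp_cts (@fst_cts _ I) (@snd_cts I I)).
  + apply: (comp_cts (f := fun z : (I * I) * I => (z.2, z.1.2)) _ cK).
    exact: pair_cts (@snd_cts _ I) (comp_cts (@fst_cts _ I) (@snd_cts I I)).
  + by move=> z; have [_ ->] := Hb z.2; have [->] := Kb z.2.
- rewrite /path_cat; case: ifP => _; [exact: H01|exact: K01].
- by rewrite !path_cat0 !path_cat1; have [-> _] := Hb t; have [_ ->] := Kb t.
Qed.

Lemma path_cat_assoc u v w :
  continuous u -> continuous v -> continuous w -> u I1 = v I0 -> v I1 = w I0 ->
  path_homotopic (path_cat (path_cat u v) w) (path_cat u (path_cat v w)).
Proof.
move=> cu cv cw uv vw.
(* The change of parameter maps [0, 1/4], [1/4, 1/2], [1/2, 1] linearly onto [0, 1/2], [1/2, 3/4],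
   [3/4, 1]. Its slopes 2, 1, 1/2 decrease, so it is concave and equals the minimum of its three
   linear pieces. *)
pose f (r : R) := Num.min (2 * r) (Num.min (r + 4^-1) (2^-1 * r + 2^-1)).
have -> : path_cat (path_cat u v) w =
    path_cat u (path_cat v w) \o (fun s => clamp (f (set_val s))).
  apply/funext => s /=; have /andP[] := set_val_I01 s; rewrite /path_cat.
  move: (set_val s) => r r0 r1; have [r2|r2] := leP r 2^-1; last first.
    have -> : f r = 2^-1 * r + 2^-1.
      by rewrite /f; case: (leP (_ + 4^-1)) => ?; case: leP => ?; lra.
    rewrite (set_val_clamp (r := 2^-1 * r + 2^-1)); last by lra.
    rewrite ifF; last by lra.
    rewrite set_val_clamp; last by lra.
    rewrite ifF; last by lra.
    by congr (w (clamp _)); lra.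
  rewrite set_val_clamp; last by lra.
  have [r4|r4] := leP (2 * r) 2^-1.
    have -> : f r = 2 * r.
      by rewrite /f; case: (leP (_ + 4^-1)) => ?; case: leP => ?; lra.
    by rewrite set_val_clamp ?r4//; lra.
  have -> : f r = r + 4^-1.
    by rewrite /f; case: (leP (_ + 4^-1)) => ?; case: leP => ?; lra.
  rewrite set_val_clamp; last by lra.
  rewrite ifF; last by lra.
  rewrite set_val_clamp; last by lra.
  rewrite ifT; last by lra.
  by congr (v (clamp _)); lra.
have cm (k : R) : continuous (fun s : I => k * set_val s).
  exact: mul_cts (@cst_continuous I R k) set_val_continuous.
apply: (@path_homotopic_reparam _ _ id).
- apply: path_cat_continuous => //; last by rewrite path_cat0.
  exact: path_cat_continuous.
- apply: comp_cts clamp_continuous; apply: min_cts (cm 2) _.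
  apply: min_cts (add_cts set_val_continuous _) (add_cts (cm _) _);
    exact: cst_continuous.
- exact: id_cts.
- rewrite -[RHS]clampK set_val_I0; congr clamp.
  by rewrite /f; case: (leP (_ + 4^-1)) => ?; case: leP => ?; lra.
- rewrite -[RHS]clampK set_val_I1; congr clamp.
  by rewrite /f; case: (leP (_ + 4^-1)) => ?; case: leP => ?; lra.
Qed.

Lemma path_cat_cst u : continuous u ->
  path_homotopic (path_cat u (fun=> u I1)) u.
Proof.
move=> cu.
(* Concatenating with the constant path means running [u] at double speed and then waiting at time
   1. *)
have -> : path_cat u (fun=> u I1) =
    u \o (fun s => clamp (Num.min 1 (2 * set_val s))).
  apply/funext => s; rewrite /path_cat /= minEle; case: leP => s2.
    by case: ifP => // s1; congr (u (clamp _)); lra.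
  by rewrite ifT//; lra.
apply: (@path_homotopic_reparam _ _ id) => //.
- apply: comp_cts clamp_continuous; apply: min_cts.
    exact: cst_continuous.
  exact: mul_cts (@cst_continuous I R 2) set_val_continuous.
- exact: id_cts.
- by rewrite set_val_I0 mulr0 (min_idPr ler01).
- by rewrite set_val_I1 mulr1 (min_idPl _)// ler1n.
Qed.

Definition path_rev u (s : I) := u (clamp (1 - set_val s)).

Lemma path_rev0 u : path_rev u I0 = u I1.
Proof. by rewrite /path_rev set_val_I0 subr0. Qed.

Lemma path_rev1 u : path_rev u I1 = u I0.
Proof. by rewrite /path_rev set_val_I1 subrr. Qed.

Lemma path_rev_continuous u : continuous u -> continuous (path_rev u).
Proof.
apply: comp_cts; apply: comp_cts clamp_continuous.
exact: sub_cts (@cst_continuous I R 1) set_val_continuous.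
Qed.

Lemma path_cat_rev u : continuous u ->
  path_homotopic (path_cat u (path_rev u)) (fun=> u I0).
Proof.
(* The tent function [f] runs from 0 up to 1 and back; both of its ends are 0, so it deforms to the
   constant parameter 0. *)
move=> cu; pose f (r : R) := Num.min (2 * r) (2 - 2 * r).
have -> : path_cat u (path_rev u) = u \o (fun s => clamp (f (set_val s))).
  apply/funext => s; have /andP[] := set_val_I01 s.
  rewrite /path_cat /path_rev /f /=; move: (set_val s) => r r0 r1.
  rewrite minEle; case: leP => r2; first by rewrite ifT//; lra.
  rewrite ifF; last by lra.
  by rewrite set_val_clamp; [congr (u (clamp _))|]; lra.
apply: (@path_homotopic_reparam _ _ (fun=> I0)) => //.
- apply: comp_cts clamp_continuous.
  have c2 := mul_cts (@cst_continuous I R 2) set_val_continuous.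
  exact: min_cts c2 (sub_cts (@cst_continuous I R 2) c2).
- exact: cst_continuous.
- by rewrite /f set_val_I0 mulr0 subr0 (min_idPl _).
- by rewrite /f set_val_I1 mulr1 subrr (min_idPr _).
Qed.

End Homotopy.

Lemma path_homotopic_map {T U : topologicalType} (f : T -> U) (u v : I -> T) :
  continuous f -> path_homotopic u v -> path_homotopic (f \o u) (f \o v).
Proof.
move=> cf [H [cH H01 Hb]]; exists (f \o H); split=> [z|s|t] /=.
- by move: z; exact: comp_cts cH cf.
- by have [-> ->] := H01 s.
- by have [-> ->] := Hb t.
Qed.

End PathHomotopy.

(** * Orbit configurations and the action of pairs [(g, s)] *)

Section Configurations.
Context {G : finGroupType} {M : topologicalType} {a : left_action G M} {n : nat}.
Implicit Types (y : conf a n) (s t : 'S_n) (g h : 'I_n -> G).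

Lemma Gorbit_self (p : M) : Gorbit a p p.
Proof. by exists 1%g => //; exact: left_act1. Qed.

Lemma conf_act1 y : conf_act (fun=> 1%g) y = y.
Proof. by apply/val_inj/funext => i; exact: left_act1. Qed.

Lemma conf_perm1 y : conf_perm y 1 = y.
Proof. by apply/val_inj/funext => i /=; rewrite perm1. Qed.

Lemma conf_orbit_inj y i j (h : G) :
  set_val y i = a h (set_val y j) -> i = j.
Proof.
move=> yij; apply/eqP/negP => /negP ij.
have /seteqP[+ _] := set_mem (valP y) i j ij; move=> /(_ (set_val y i)); apply.
by split; [exact: Gorbit_self|exists h].
Qed.

Lemma free_act_inj (p : M) (g h : G) :
  free_type a p -> a g p = a h p -> g = h.
Proof.
move=> fp gh; have /= : isotropy a p (h^-1 * g)%g.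
  by rewrite /isotropy /= left_actM gh -left_actM mulVg left_act1.
by rewrite fp => /(canRL (mulKVg h)); rewrite mulg1.
Qed.

(** Distinct coordinates of [x] lie in distinct orbits, so comparing coordinates up to [G] gives
    [s = t]; freeness of the orbits then gives [g = h]. *)
Lemma conf_orb_inj (x : conf a n) g h s t :
  (forall i, free_type a (set_val x i)) ->
  conf_act g (conf_perm x s) = conf_act h (conf_perm x t) -> g = h /\ s = t.
Proof.
move=> fx e; have {}e i : a (g i) (set_val x (s i)) = a (h i) (set_val x (t i)).
  by have := congr1 (fun y => set_val y i) e.
have st : s = t.
  apply/permP => i; apply: (@conf_orbit_inj x _ _ ((g i)^-1 * h i)%g).
  by rewrite left_actM -e -left_actM mulVg left_act1.
split=> //; apply/funext => i.
by have := e i; rewrite st; exact: free_act_inj.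
Qed.

Lemma conf_act_perm_continuous g s :
  continuous (fun y => conf_act g (conf_perm y s)).
Proof.
apply: (@comp_cts _ _ _ (fun y => conf_perm y s) (conf_act g)).
  exact: conf_perm_continuous.
exact: conf_act_continuous.
Qed.

End Configurations.

Arguments conf_act_perm_continuous {G M a n} g s.

(** * Isotopy of strings against homotopy of paths *)

Section Isotopies.
Context {R : realType} {G : finGroupType} {M : topologicalType}.
Context {a : left_action G M} {n : nat}.
Local Notation I := (I01 R).
Implicit Types (u v : I -> conf a n) (f g : I -> M).

Lemma string_inj f g : string f = string g -> f = g.
Proof.
move=> fg; apply/funext => s; have : string g (f s, s) by rewrite -fg; exists s.
by move=> [t _ [gf ts]]; rewrite -gf ts.
Qed.

Lemma act_string_string (h : G) f :
  act_string (a := a) h (string f) = string (a h \o f).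
Proof.
apply/seteqP; split=> [_ [_ [s _ <-] <-]|_ [s _ <-]]; first by exists s.
by exists (f s, s) => //; exists s.
Qed.

Lemma at_level_strings u s :
  at_level (strings u) s = [set (set_val (u s) i, s) | i in [set: 'I_n]].
Proof.
apply/seteqP; split=> [[p r] [] /= -> [_ [i _ <-] [t _ [<- ->]]]|_ [i _ <-] /=].
  by exists i.
by split=> //; exists (string (fun s => set_val (u s) i)); [exists i|exists s].
Qed.

(** Points of a Hausdorff space are closed, so [f] has finitely many fibres, all closed. Each is
    also open, as the complement of the others, and connectedness of the interval leaves only
    one. *)
Lemma finite_valued_path_cst (c : 'I_n -> M) f : hausdorff_space M ->
  continuous f -> (forall t, exists k, f t = c k) -> forall t, f t = f I0.
Proof.
move=> hM cf fc t.
have cl (p : M) : closed (f @^-1` [set p]).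
  apply: preimage_closed => [r _|]; first exact: cf.
  exact: (@accessible_closed_set1 _ (hausdorff_accessible hM)).
suff e : f @^-1` [set f I0] = [set: I] by have : [set: I] t by []; rewrite -e.
apply: (@I01_connected R).
- by exists I0.
- exists (~` \bigcup_(k in [set k | c k <> f I0]) (f @^-1` [set c k])).
    apply: closed_openC; apply: closed_bigcup => //.
    exact: finite_finset.
  rewrite setTI; apply/seteqP; split=> r /=.
    by move=> fr [k kI fk]; apply: kI; rewrite -fk.
  move=> nr; apply: contrapT => fr; apply: nr.
  by have [k fk] := fc r; exists k => //=; rewrite -fk.
- by exists (f @^-1` [set f I0]) => //; rewrite setTI.
Qed.

(* Relabelling the [F i] so that they start on the strings of [u] in order
   turns the isotopy into a homotopy: the end points move inside a finite set,
   hence stay put, and they identify the [t = 1] strings with those of [v]. *)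
Lemma isotopic_homotopic u v :
  hausdorff_space M -> isotopic u v -> path_homotopic u v.
Proof.
move=> hM [uv0 uv1 [F [cF [F0 F1] Fl Fr FG]]].
have cF' i : continuous (F i) by exact: comp_cts (cF i) (@fst_cts M I).
have /choice[q qu] (j : 'I_n) :
    exists i, forall s, F i (s, I0) = set_val (u s) j.
  have : strings u (string (fun s => set_val (u s) j)) by exists j.
  rewrite -F0 => -[i _ /string_inj e].
  by exists i => s; exact: (congr1 (@^~ s) e).
(* Two strings of [u] with the same label would coincide at time 0, against the disjointness of the
   orbits in a configuration. *)
have q_inj : injective q.
  move=> j k jk; apply: (@conf_orbit_inj _ _ _ _ (u I0) j k 1%g).
  by rewrite left_act1 -!qu jk.
have Fconf p : (fun j => F (q j) p) \in conf_set a (n := n).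
  apply/mem_set => i j ij; case: p => s t.
  by apply: FG; rewrite (inj_eq q_inj).
have end0 j t : F (q j) (I0, t) = set_val (u I0) j.
  rewrite -qu; apply: (@finite_valued_path_cst (set_val (u I0))
    (fun t => F (q j) (I0, t))) => //.
    apply: comp_cts (cF' _).
    exact: pair_cts (@cst_continuous I I I0) (@id_cts I).
  (* The boundary condition on the unordered end points says only that this point is some coordinate
     of [u I0], which is the finiteness required. *)
  move=> r; have [+ _] := Fl r; rewrite at_level_strings => e.
  have : [set (F i (I0, r), I0 : I) | i in [set: 'I_n]] (F (q j) (I0, r), I0).
    by exists (q j).
  by rewrite e => -[k _ [<-]]; exists k.
have end1 j t : F (q j) (I1, t) = set_val (u I1) j.
  rewrite -qu; apply: (@finite_valued_path_cst (set_val (u I1))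
    (fun t => F (q j) (I1, t))) => //.
    apply: comp_cts (cF' _).
    exact: pair_cts (@cst_continuous I I I1) (@id_cts I).
  move=> r; have [+ _] := Fr r; rewrite at_level_strings => e.
  have : [set (F i (I1, r), I1 : I) | i in [set: 'I_n]] (F (q j) (I1, r), I1).
    by exists (q j).
  by rewrite e => -[k _ [<-]]; exists k.
exists (fun p => exist (fun z => z \in conf_set a (n := n)) _ (Fconf p)).
split=> [|s|t].
- by apply/continuous_comp_initial/prod_continuous => j; exact: cF'.
- split; apply/val_inj/funext => j /=; first exact: qu.
  (* At [t = 1] the string labelled [q j] is some string [k] of [v]. Both start at coordinate [j] of
     the common starting configuration, so [k = j]. *)
  have : strings v (string (fun s => F (q j) (s, I1))).
    by rewrite -F1; exists (q j).
  move=> [k _ /string_inj e].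
  have {}e r : set_val (v r) k = F (q j) (r, I1) by exact: (congr1 (@^~ r) e).
  have := e I0; rewrite end0 uv0 => kj.
  rewrite -e; congr (set_val (v s) _); apply/esym.
  by apply: (@conf_orbit_inj _ _ _ _ (v I0) j k 1%g); rewrite left_act1.
- by split; apply/val_inj/funext => j; [exact: end0|exact: end1].
Qed.

(** The coordinates of the homotopy are the required maps: its values are configurations, which
    gives disjointness of orbits, and its fixed ends give the conditions on the end points. *)
Lemma homotopic_isotopic u v : path_homotopic u v -> isotopic u v.
Proof.
move=> uv; have [H [cH H01 Hb]] := uv.
have uv0 := path_homotopic0 uv; have uv1 := path_homotopic1 uv.
split=> //; exists (fun i p => set_val (H p) i); split.
- move=> i; apply: pair_cts (@fst_cts I I).
  exact: comp_cts cH (conf_coord_continuous (i := i)).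
- split; congr image; apply/funext => i; congr image; apply/funext => s.
    by have [-> _] := H01 s.
  by have [_ ->] := H01 s.
- by move=> t; rewrite !at_level_strings uv0; have [-> _] := Hb t.
- by move=> t; rewrite !at_level_strings uv1; have [_ ->] := Hb t.
- by move=> s t i j; exact: (set_mem (valP (H (s, t)))).
Qed.

End Isotopies.

(** * Equivalence of orbit braids is homotopy of orbit paths *)

Section FreeBasePoint.
Context {R : realType} {G : finGroupType} {M : topologicalType}.
Context {a : left_action G M} {n : nat} {x : conf a n}.
Hypothesis fx : forall i, free_type a (set_val x i).
Local Notation I := (I01 R).
Implicit Types (alpha beta gamma : orb_path R x).

Lemma homotopic_equivalence : Equivalence (@homotopic R G M a n x).
Proof.
split=> [alpha|alpha beta|alpha beta gamma].
- by apply: path_homotopic_refl; exact: orb_path_continuous.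
- exact: path_homotopic_sym.
- exact: path_homotopic_trans.
Qed.

(** The string of [alpha] at index [i] lies in an orbit string of [beta], so it is a translate, by
    one fixed [h], of the string of [beta] at some [j]. At time 0 this reads [x_i = h x_j], whence
    [i = j], and freeness gives [h = 1]. *)
Lemma orbit_strings_inj alpha beta :
  orbit_strings alpha = orbit_strings beta -> alpha = beta :> (I -> conf a n).
Proof.
move=> ab; apply/funext => s; apply/val_inj/funext => i.
have : orbit_strings alpha
    (orbit_string (a := a) (string (fun s => set_val (alpha s) i))).
  by eexists; [exists i|].
rewrite ab => -[_ [j _ <-] e].
have : orbit_string (a := a) (string (fun s => set_val (alpha s) i))
    (string (fun s => set_val (alpha s) i)).
  exists 1%g => //; rewrite act_string_string; congr string.
  by apply/funext => r; exact: left_act1.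
rewrite -e => -[h _]; rewrite act_string_string => /string_inj {}e.
have {}e r : set_val (alpha r) i = a h (set_val (beta r) j).
  by rewrite -[LHS](congr1 (@^~ r) e).
have := e I0; rewrite !orb_path0 => e0; have ij := conf_orbit_inj e0.
have h1 : h = 1%g.
  by apply: (free_act_inj (fx j)); rewrite -e0 left_act1 ij.
by rewrite [LHS]e h1 left_act1 ij.
Qed.

Lemma braid_equivP alpha beta : hausdorff_space M ->
  braid_equiv (braid_of alpha) (braid_of beta) <-> homotopic alpha beta.
Proof.
move=> hM; split=> [[alpha' [beta' [ea eb [g [h gh]]]]]|ab]; last first.
  exists alpha, beta; split=> //; exists (fun=> 1%g), (fun=> 1%g).
  apply: homotopic_isotopic.
  under eq_fun do rewrite conf_act1.
  by under [X in path_homotopic _ X]eq_fun do rewrite conf_act1.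
(* The equivalence provides its own representing paths; they are the given ones, since an orbit
   braid determines its path. *)
have {}ea := orbit_strings_inj (congr1 sval ea).
have {}eb := orbit_strings_inj (congr1 sval eb).
rewrite -ea -eb in gh.
(* The isotopic paths start at [g x] and [h x], so [g = h]; translating the homotopy by the inverse
   of [g] removes the common factor. *)
have [gh0 _ _] := gh; rewrite !orb_path0 -(conf_perm1 x) in gh0.
have [{gh0} hg _] := conf_orb_inj fx gh0; rewrite -{}hg {h} in gh.
have gV (u : I -> conf a n) :
    conf_act (fun i => (g i)^-1)%g \o (fun s => conf_act g (u s)) = u.
  apply/funext => s /=; rewrite conf_actM -[RHS]conf_act1.
  by congr conf_act; apply/funext => i; rewrite mulVg.
have := path_homotopic_map (conf_act_continuous (g := fun i => (g i)^-1)%g)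
  (isotopic_homotopic hM gh).
by rewrite !gV.
Qed.

Lemma orb_path_reps (B : orbit_braid R x) : exists alpha, B = braid_of alpha.
Proof. by case: B => B [alpha Ba]; exists alpha; exact/eq_exist. Qed.

Lemma braid_equiv_equivalence :
  hausdorff_space M -> Equivalence (@braid_equiv R G M a n x).
Proof.
move=> hM; have [hr hs ht] := homotopic_equivalence; split=> [B|B C|B C D].
- by have [alpha ->] := orb_path_reps B; apply/braid_equivP.
- have [alpha ->] := orb_path_reps B; have [beta ->] := orb_path_reps C.
  by move=> /(braid_equivP _ _ hM) ab; apply/braid_equivP => //; exact: hs.
- have [alpha ->] := orb_path_reps B; have [beta ->] := orb_path_reps C.
  have [gamma ->] := orb_path_reps D.
  move=> /(braid_equivP _ _ hM) ab /(braid_equivP _ _ hM) bc.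
  by apply/braid_equivP => //; exact: ht bc.
Qed.

(** * Concatenation of orbit paths: associativity, unit and inverses up to homotopy *)

Lemma orb_cat_homotopic alpha alpha' beta beta' g g' s s'
    (alpha1 : alpha I1 = conf_act g (conf_perm x s))
    (alpha'1 : alpha' I1 = conf_act g' (conf_perm x s')) :
  homotopic alpha alpha' -> homotopic beta beta' ->
  homotopic (orb_cat beta alpha1) (orb_cat beta' alpha'1).
Proof.
(* Homotopic paths have the same end point, so uniqueness identifies the two pairs used to translate
   [beta] and [beta']. *)
move=> aa bb; have := path_homotopic1 aa; rewrite alpha1 alpha'1.
move=> /(conf_orb_inj fx)[gg ss]; subst g' s'.
apply: path_homotopic_cat => //; first by rewrite alpha1 orb_path0.
exact: path_homotopic_map (conf_act_perm_continuous g s) bb.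
Qed.

(** End pairs multiply as in the wreath product of [G] with the symmetric group. *)
Lemma orb_cat_end alpha beta g h s t
    (alpha1 : alpha I1 = conf_act g (conf_perm x s)) :
  beta I1 = conf_act h (conf_perm x t) ->
  orb_cat beta alpha1 I1 =
    conf_act (fun i => (g i * h (s i))%g) (conf_perm x (s * t)).
Proof.
move=> beta1; rewrite /= /orb_cat_fun path_cat1 beta1.
by rewrite conf_act_perm conf_actM conf_permA.
Qed.

(** Translation by [(g, s)] distributes over concatenation and composes with translation by [(h, t)]
    to the product pair, so this is associativity for three ordinary paths, read from right to
    left. *)
Lemma orb_cat_assoc alpha beta gamma g h s t
    (alpha1 : alpha I1 = conf_act g (conf_perm x s))
    (beta1 : beta I1 = conf_act h (conf_perm x t)) :
  homotopic (orb_cat (orb_cat gamma beta1) alpha1)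
            (orb_cat gamma (orb_cat_end alpha1 beta1)).
Proof.
apply: path_homotopic_sym; rewrite /= /orb_cat_fun.
pose k (y : conf a n) := conf_act g (conf_perm y s).
have -> : (fun r => conf_act g (conf_perm
      (path_cat beta (fun r => conf_act h (conf_perm (gamma r) t)) r) s)) =
    path_cat (k \o beta)
      (fun r => conf_act (fun i => (g i * h (s i))%g)
                  (conf_perm (gamma r) (s * t))).
  apply/funext => r; rewrite /path_cat /k /=; case: ifP => // _.
  by rewrite conf_act_perm conf_actM conf_permA.
have ck := conf_act_perm_continuous (a := a) g s.
apply: path_cat_assoc.
- exact: orb_path_continuous.
- exact: comp_cts (@orb_path_continuous _ _ _ _ _ _ beta) ck.
- exact: comp_cts (@orb_path_continuous _ _ _ _ _ _ gamma)
    (conf_act_perm_continuous _ _).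
- by rewrite alpha1 /= orb_path0.
- by rewrite /= /k beta1 orb_path0 conf_act_perm conf_actM conf_permA.
Qed.

Lemma base_conf_orb : conf_orb x x.
Proof. by exists (fun=> 1%g), 1%g; rewrite conf_act1 conf_perm1. Qed.

Definition orb_cst : orb_path R x :=
  OrbPath (@cst_continuous I _ x) erefl base_conf_orb.

(** The translate of the constant path at [x] by the end pair of [alpha] is the constant path at the
    end of [alpha]. *)
Lemma orb_cat_cst alpha g s (alpha1 : alpha I1 = conf_act g (conf_perm x s)) :
  homotopic (orb_cat orb_cst alpha1) alpha.
Proof.
rewrite /homotopic /= /orb_cat_fun /= -alpha1.
exact: path_cat_cst (@orb_path_continuous _ _ _ _ _ _ alpha).
Qed.

Section Inverse.
Context (alpha : orb_path R x) (g : 'I_n -> G) (s : 'S_n).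
Hypothesis alpha1 : alpha I1 = conf_act g (conf_perm x s).

(** The inverse of the translation by [(g, s)]. The reversed path starts at [g x_s], and [back]
    brings that point to [x]; translating again in the concatenation restores the plain reversed
    path. *)
Let back (y : conf a n) : conf a n :=
  conf_perm (conf_act (fun i => (g i)^-1)%g y) s^-1.

Let backK y : conf_act g (conf_perm (back y) s) = y.
Proof.
rewrite /back conf_permA mulgV conf_perm1 conf_actM -[RHS]conf_act1.
by congr conf_act; apply/funext => i; rewrite mulgV.
Qed.

Let inv_continuous : continuous (back \o path_rev alpha).
Proof.
apply: comp_cts (path_rev_continuous (@orb_path_continuous _ _ _ _ _ _ alpha)) _.
apply: (@comp_cts _ _ _ _ (fun y => conf_perm y s^-1)).
  exact: conf_act_continuous.
exact: conf_perm_continuous.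
Qed.

Let inv0 : (back \o path_rev alpha) I0 = x.
Proof.
rewrite /= path_rev0 alpha1 /back conf_actM.
under [X in conf_act X]eq_fun do rewrite mulVg.
by rewrite conf_act1 conf_permA mulVg conf_perm1.
Qed.

Let inv1 : conf_orb x ((back \o path_rev alpha) I1).
Proof.
by rewrite /= path_rev1 orb_path0 /back conf_act_perm; eexists _, _.
Qed.

Definition orb_inv : orb_path R x := OrbPath inv_continuous inv0 inv1.

Lemma orb_cat_inv : homotopic (orb_cat orb_inv alpha1) orb_cst.
Proof.
rewrite /homotopic /= /orb_cat_fun.
have -> : (fun t => conf_act g (conf_perm (orb_inv t) s)) = path_rev alpha.
  by apply/funext => t; exact: backK.
have := path_cat_rev (@orb_path_continuous _ _ _ _ _ _ alpha).
by rewrite orb_path0.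
Qed.

End Inverse.

(** * The group structure on the extended fundamental group *)

Definition orb_mul alpha beta : orb_path R x :=
  orb_cat beta (svalP (cid (svalP (cid (orb_path1 alpha))))).

Definition pi1E_mul (u v : pi1E R x) : pi1E R x :=
  pi1E_class (orb_mul (quot_rep u) (quot_rep v)).

(** The product is defined with chosen representatives and a chosen end pair; invariance of
    concatenation under homotopy makes it independent of these choices. *)
Lemma pi1E_mulE alpha beta g s
    (alpha1 : alpha I1 = conf_act g (conf_perm x s)) :
  pi1E_mul (pi1E_class alpha) (pi1E_class beta) =
    pi1E_class (orb_cat beta alpha1).
Proof.
apply/(proj_quotP _ _ homotopic_equivalence).
by apply: orb_cat_homotopic; exact: quot_rep_proj homotopic_equivalence.
Qed.

Lemma pi1E_group : is_group pi1E_mul.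
Proof.
have eqP := proj_quotP _ _ homotopic_equivalence.
apply: (@is_group_right _ _ (pi1E_class orb_cst)) => [u v w|u|u].
- rewrite -(quot_repK u) -(quot_repK v) -(quot_repK w).
  move: (quot_rep u) (quot_rep v) (quot_rep w) => alpha beta gamma.
  have [g [s alpha1]] := orb_path1 alpha; have [h [t beta1]] := orb_path1 beta.
  rewrite -!/(pi1E_class _) (pi1E_mulE _ alpha1) (pi1E_mulE _ beta1).
  rewrite (pi1E_mulE _ alpha1) (pi1E_mulE _ (orb_cat_end alpha1 beta1)).
  exact/eqP/orb_cat_assoc.
- rewrite -(quot_repK u); move: (quot_rep u) => alpha.
  have [g [s alpha1]] := orb_path1 alpha.
  by rewrite -!/(pi1E_class _) (pi1E_mulE _ alpha1); exact/eqP/orb_cat_cst.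
- rewrite -(quot_repK u); move: (quot_rep u) => alpha.
  have [g [s alpha1]] := orb_path1 alpha.
  exists (pi1E_class (orb_inv alpha1)).
  by rewrite -!/(pi1E_class _) (pi1E_mulE _ alpha1); exact/eqP/orb_cat_inv.
Qed.

(** * The map [Lambda] and its bijectivity *)

Definition pi1E_braid (u : pi1E R x) : orbit_braid_group R x :=
  braid_class (quot_rep u).

Lemma pi1E_braidE alpha : hausdorff_space M ->
  pi1E_braid (pi1E_class alpha) = braid_class alpha.
Proof.
move=> hM; apply/(proj_quotP _ _ (braid_equiv_equivalence hM))/braid_equivP => //.
exact: quot_rep_proj homotopic_equivalence.
Qed.

Lemma pi1E_braid_bijective : hausdorff_space M -> bijective pi1E_braid.
Proof.
move=> hM; have /choice[r rP] (b : orbit_braid_group R x) :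
    exists alpha : orb_path R x, b = braid_class alpha.
  rewrite -(quot_repK b); have [alpha ->] := orb_path_reps (quot_rep b).
  by exists alpha.
exists (fun b => pi1E_class (r b)) => [u|b].
  (* For injectivity, two paths with the same braid class have equivalent orbit braids and are
     therefore homotopic. *)
  rewrite -[RHS]quot_repK; apply/(proj_quotP _ _ homotopic_equivalence).
  apply/(braid_equivP _ _ hM)/(proj_quotP _ _ (braid_equiv_equivalence hM)).
  by rewrite -!/(braid_class _) -rP.
by rewrite pi1E_braidE// -rP.
Qed.

End FreeBasePoint.

Theorem theorem1p1 (R : realType) (d : nat) (M : topologicalType)
    (G : finGroupType) (a : left_action G M) (n : nat) (x : conf a n) :
  topological_manifold R d M -> (2 <= d)%N -> connected [set: M] ->
  effective a -> (2 <= n)%N -> (forall i, free_type a (set_val x i)) ->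
  Equivalence (@homotopic R G M a n x) /\
  Equivalence (@braid_equiv R G M a n x) /\
  exists (mulE : pi1E R x -> pi1E R x -> pi1E R x)
         (mulB : orbit_braid_group R x -> orbit_braid_group R x ->
                 orbit_braid_group R x)
         (Lambda : pi1E R x -> orbit_braid_group R x),
    (forall (alpha beta : orb_path R x) (g : 'I_n -> G) (s : 'S_n)
            (alpha1 : alpha I1 = conf_act g (conf_perm x s)),
       mulE (pi1E_class alpha) (pi1E_class beta) =
         pi1E_class (orb_cat beta alpha1) /\
       mulB (braid_class alpha) (braid_class beta) =
         braid_class (orb_cat beta alpha1)) /\
    is_group mulE /\
    is_group mulB /\
    (forall alpha : orb_path R x,
       Lambda (pi1E_class alpha) = braid_class alpha) /\
    bijective Lambda /\
    {morph Lambda : u v / mulE u v >-> mulB u v}.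
Proof.
move=> [hM _ _] _ _ _ _ fx; split; first exact: homotopic_equivalence.
split; first exact: braid_equiv_equivalence.
have [Lambda' LK L'K] := pi1E_braid_bijective (R := R) fx hM.
(* The operation on orbit braids is transported along [Lambda], so the group laws and the morphism
   property are immediate. *)
exists pi1E_mul, (fun b c => pi1E_braid (pi1E_mul (Lambda' b) (Lambda' c))).
exists pi1E_braid; split.
  move=> alpha beta g s alpha1; split; first exact: pi1E_mulE.
  (* Every braid class of a path is its image under [Lambda], so the transported operation is indeed
     the gluing of orbit braids. *)
  by rewrite -!(pi1E_braidE fx)// !LK (pi1E_mulE fx _ alpha1).
split; first exact: pi1E_group.
split; first by apply: is_group_transport LK L'K (pi1E_group fx).
split; first by move=> alpha; exact: pi1E_braidE.
split; first by exists Lambda'.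
by move=> u v; rewrite !LK.
Qed.
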